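(* Fix an integer $h>0$. Then, as $k \to \infty$, \[ E(h,k) \sim (h-1)\,\frac{\log k}{\log\log k}. \]
   Context: Let $\mathbb{N}$ denote the set of positive integers. For $A\subseteq \mathbb{N}$ and a positive integer $h$, $hA$ is the set of all sums of exactly $h$ not necessarily distinct elements of $A$. We write $hA\sim\mathbb{N}$ if all but finitely many positive integers lie in $hA$. A set $A\subseteq\mathbb{N}$ is a basis of order $h$ if $hA\sim\mathbb{N}$ but $(h-1)A\not\sim\mathbb{N}$; $A$ is a basis (of some order) if it is a basis of order $h$ for some $h$. If $A$ is a basis, a finite subset $E\subseteq A$ is an essential subset of $A$ if $A\setminus E$ is not a basis of any order, and $E$ is minimal (with respect to inclusion) with this property. $E(h,k)$ denotes the maximum possible number of essential subsets of size $k$ in a basis of order $h$ (this maximum is finite). The notation $F(k)\sim G(k)$ means $F(k)/G(k)\to 1$ as $k\to\infty$. *)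

(* Defs.v *)
From mathcomp Require Import all_boot.
From mathcomp Require Import finmap.
From Stdlib Require Import Reals ClassicalEpsilon.

Set Implicit Arguments.
Unset Strict Implicit.
Unset Printing Implicit Defensive.

Local Open Scope fset_scope.

Definition subset_pos (A : nat -> Prop) : Prop := forall a, A a -> 0 < a.

Definition in_sumset (h : nat) (A : nat -> Prop) (n : nat) : Prop :=
  exists s : seq nat, size s = h /\ (forall x, x \in s -> A x) /\ sumn s = n.

Definition sumset_cofinite (h : nat) (A : nat -> Prop) : Prop :=
  exists N0 : nat, forall n, N0 <= n -> 0 < n -> in_sumset h A n.

Definition basis_of_order (h : nat) (A : nat -> Prop) : Prop :=
  subset_pos A /\ sumset_cofinite h A /\ ~ sumset_cofinite h.-1 A.

Definition is_basis (A : nat -> Prop) : Prop := exists h, basis_of_order h A.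

Definition setminus_f (A : nat -> Prop) (E : {fset nat}) : nat -> Prop :=
  fun n => A n /\ n \notin E.

Definition essential (A : nat -> Prop) (E : {fset nat}) : Prop :=
  (forall x, x \in E -> A x) /\
  ~ is_basis (setminus_f A E) /\
  (forall E' : {fset nat}, E' `<` E -> is_basis (setminus_f A E')).

Definition has_m_essential (h k m : nat) : Prop :=
  exists A : nat -> Prop, basis_of_order h A /\
    exists s : seq {fset nat}, uniq s /\ size s = m /\
      (forall E, E \in s -> essential A E /\ #|` E| = k).

Definition is_max_essential (h k m : nat) : Prop :=
  has_m_essential h k m /\ (forall m', has_m_essential h k m' -> m' <= m).

(* E(h,k): the maximum (chosen by classical description; it exists). *)
Definition Ehk (h k : nat) : nat :=
  epsilon (inhabits 0) (fun m => is_max_essential h k m).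

(* Asymptotic equivalence F ~ G as k -> oo, in the form F = G + o(G):
   for every eps > 0, eventually |F k - G k| <= eps |G k|.  When G is
   eventually nonzero this is exactly F k / G k -> 1. *)
Definition asymp_equiv (F G : nat -> R) : Prop :=
  forall eps : R, (0 < eps)%R ->
    exists K : nat, forall k : nat, (K <= k)%nat ->
      (Rabs (F k - G k) <= eps * Rabs (G k))%R.

(* Main.v *)
(* By the Erdős–Graham argument, [A \ E] fails to be a basis only if it lies in one
   residue class modulo a prime; minimality makes the primes attached to distinct
   essential sets distinct.

   Upper bound: let [P] be the product of the [m] primes and [U] the union of the
   [m] essential sets, so that [A \ U] is a single class mod [P]. A large integer
   uses a summand outside [U], so the sums of [h - 1] elements of [U] plus one
   further class cover Z/P, whence [(m + 1)! <= P <= (m k + 1) ^ (h - 1)].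

   Lower bound: split [(h - 1) r] small primes into [h - 1] blocks with products at
   most [k]. All multiples of [P], together with one representative of each residue
   mod [P] supported on a single block, form a basis of order [h] in which every
   prime defines an essential set; multiples of [P / p] pad that of [p] to size [k].
   Enough small primes come from [2 ^ n <= 'C(2n, n) <= (2n) ^ pi(2n)]. *)

Require Import Defs.
From mathcomp Require Import all_boot.
From Stdlib Require Import Reals.
From mathcomp Require Import finmap zify.
From Stdlib Require Import Classical ClassicalEpsilon Lra Lia.
(* Reals rebinds [^] to [Nat.pow]; this restores [expn]. *)
From mathcomp Require Import ssrnat.

Set Implicit Arguments.
Unset Strict Implicit.
Unset Printing Implicit Defensive.

(** * Bases and residue classes *)

Lemma in_sumset_add h1 h2 B n1 n2 :
  in_sumset h1 B n1 -> in_sumset h2 B n2 -> in_sumset (h1 + h2) B (n1 + n2).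
Proof.
move=> [s1 [<- [B1 <-]]] [s2 [<- [B2 <-]]].
exists (s1 ++ s2); rewrite size_cat sumn_cat; do 2!split => //.
by move=> x; rewrite mem_cat => /orP[/B1|/B2].
Qed.

Lemma in_sumset_mul c h B n :
  in_sumset h B n -> in_sumset (c * h) B (c * n).
Proof.
move=> Bn; elim: c => [|c IH]; first by exists [::].
by rewrite !mulSn; apply: in_sumset_add.
Qed.

Lemma in_sumset1 (B : nat -> Prop) b : B b -> in_sumset 1 B b.
Proof.
move=> Bb; exists [:: b]; split=> //; split; last by rewrite /= addn0.
by move=> x; rewrite inE => /eqP->.
Qed.

Lemma least_nat (Q : nat -> Prop) n :
  Q n -> exists2 m, Q m & forall i, i < m -> ~ Q i.
Proof.
have [m] := ubnP n; elim: m n => // m IH n ltnm Qn.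
have [[i [ltin Qi]]|noi] := classic (exists i, i < n /\ Q i).
  by apply: (IH i) => //; apply: leq_trans ltin _.
by exists n => // i ltin Qi; apply: noi; exists i.
Qed.

Lemma sumset0_not_cofinite A : ~ sumset_cofinite 0 A.
Proof.
move=> [N0 H]; have [||s] := H N0.+1; try lia.
by case=> /size0nil-> [_].
Qed.

Lemma sumset_cofinite_is_basis h A :
  subset_pos A -> sumset_cofinite h A -> is_basis A.
Proof.
move=> Apos /(least_nat (Q := fun h => sumset_cofinite h A))[[|m] Am minm].
  by case: (sumset0_not_cofinite Am).
by exists m.+1; do 2!split=> //; apply: minm.
Qed.

Lemma sumn_modn p c s :
  (forall x, x \in s -> x = c %[mod p]) -> sumn s = size s * c %[mod p].
Proof.
elim: s => //= x s IH H; rewrite mulSn -[LHS]modnDm -[RHS]modnDm (H x) ?mem_head // IH //.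
by move=> y sy; apply: H; rewrite inE sy orbT.
Qed.

(** All sums of [h] elements lie in the single class of [h * c], whereas two consecutive large
    integers are never congruent modulo [p > 1]. *)
Lemma not_cofinite_modn p c h A :
  1 < p -> (forall x, A x -> x = c %[mod p]) -> ~ sumset_cofinite h A.
Proof.
move=> p1 Ac [N0 HN].
have sub n : N0 < n -> n = h * c %[mod p].
  move=> ltn; have [||s [sz [As <-]]] := HN n; try lia.
  by rewrite -sz; apply: sumn_modn => x /As/Ac.
have := etrans (sub N0.+2 (leqW (leqnn _))) (esym (sub N0.+1 (leqnn _))).
by move/eqP; rewrite eqn_mod_dvd // subSnn dvdn1 => /eqP p_eq1; rewrite p_eq1 in p1.
Qed.

Lemma mod_class_not_basis p A :
  1 < p -> (forall x y, A x -> A y -> x = y %[mod p]) -> ~ is_basis A.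
Proof.
move=> p1 Amod [h [_ [cof _]]].
have [[c Ac]|noA] := classic (exists c, A c).
  by apply: (not_cofinite_modn (c := c) p1 _ cof) => x Ax; apply: Amod.
by apply: (not_cofinite_modn (c := 0) p1 _ cof) => x Ax; case: noA; exists x.
Qed.

(** These [d] are the nonnegative elements of the subgroup of Z generated by the differences of
    elements of [B]. *)
Definition sumset_gap (B : nat -> Prop) (d : nat) : Prop :=
  exists r x, in_sumset r B x /\ in_sumset r B (x + d).

Lemma sumset_gapD B d1 d2 :
  sumset_gap B d1 -> sumset_gap B d2 -> sumset_gap B (d1 + d2).
Proof.
move=> [r1 [x1 [lo1 hi1]]] [r2 [x2 [lo2 hi2]]]; exists (r1 + r2), (x1 + x2).
split; first exact: in_sumset_add.
by rewrite addnACA; apply: in_sumset_add.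
Qed.

Lemma sumset_gapB B d1 d2 :
  sumset_gap B d1 -> sumset_gap B d2 -> sumset_gap B (d1 - d2).
Proof.
have [le12|lt21] := leqP d1 d2.
  move=> [r [x [lo _]]] _; exists r, x.
  by rewrite (eqP le12) addn0.
move=> [r1 [x1 [lo1 hi1]]] [r2 [x2 [lo2 hi2]]]; exists (r1 + r2), (x1 + (x2 + d2)).
split; first exact: in_sumset_add.
have -> : x1 + (x2 + d2) + (d1 - d2) = x1 + d1 + x2 by lia.
exact: in_sumset_add.
Qed.

Lemma sumset_gap_mul B c d : sumset_gap B d -> sumset_gap B (c * d).
Proof.
move=> gd; elim: c => [|c IH]; last by rewrite mulSn; apply: sumset_gapD.
by rewrite mul0n -(subnn d); apply: sumset_gapB.
Qed.

(* Swapping the summands outside [E] for multiples of a fixed [a0], and letting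
   the sums around [L x] absorb the bounded contribution of [E], makes the number
   of summands constant. *)
Lemma setminus_basis h A E a0 :
  subset_pos A -> sumset_cofinite h A -> setminus_f A E a0 ->
  sumset_gap (setminus_f A E) 1 -> is_basis (setminus_f A E).
Proof.
move=> Apos [N0 HN] Ba0 [r [x [Bx Bx1]]]; set B := setminus_f A E in Ba0 Bx Bx1 *.
pose M := \sum_(e <- E) e.
have leM e : e \in E -> e <= M.
  by move=> eE; rewrite /M (big_rem e) //= leq_addr.
pose L := h * M + h * a0.
have Bint d : d <= L -> in_sumset (L * r) B (L * x + d).
  move=> ledL; have -> : L * x + d = (L - d) * x + d * (x + 1) by nia.
  have -> : L * r = (L - d) * r + d * r by nia.
  by apply: in_sumset_add; apply: in_sumset_mul.
apply: (@sumset_cofinite_is_basis (h + L * r)); first by move=> a [/Apos].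
exists (N0 + L * x + h * a0).+1 => n len _.
have [||s [sz [As sumE]]] := HN (n - (L * x + h * a0)); try lia.
(* Pair each summand [e] with one [a0]. If [e] lies in [E], then [a0] goes to [v] and [e] to the
   defect [d]; otherwise the roles are exchanged. So [v] keeps [size s] summands outside [E], and
   [d] gains at most [M + a0] per summand. *)
suff [d [led sd]] : exists d, d <= size s * (M + a0) /\
    exists v, in_sumset (size s) B v /\ v + d = sumn s + size s * a0.
  have [v [Bv vd]] := sd.
  have -> : n = v + (L * x + d) by rewrite sz in vd; nia.
  by rewrite -{1}sz; apply: in_sumset_add => //; apply: Bint; rewrite /L -mulnDr -sz.
elim: s As {sz sumE} => [|e s IH] As; first by exists 0; split=> //; exists 0; split=> //; exists [::].
have [|d [led [v [Bv vd]]]] := IH; first by move=> y sy; apply: As; rewrite inE sy orbT.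
have Ae : A e by apply: As; rewrite mem_head.
have [eE|eE] := boolP (e \in E).
  exists (d + e); split; first by have := leM e eE; rewrite /= mulSn; lia.
  exists (v + a0); split; last by rewrite /= mulSn; lia.
  by rewrite /= -addn1; apply: in_sumset_add => //; apply: in_sumset1.
exists (d + a0); split; first by rewrite /= mulSn; lia.
exists (v + e); split; last by rewrite /= mulSn; lia.
by rewrite /= -addn1; apply: in_sumset_add => //; apply: in_sumset1.
Qed.

(** Every gap is a multiple of the least positive gap [g]. Since [g = 1] would give a basis by
    [setminus_basis], [g] has a prime divisor, which divides all differences. If there is no element
    or no positive gap, the prime 2 serves. *)
Lemma not_basis_prime h A E :
  subset_pos A -> sumset_cofinite h A -> ~ is_basis (setminus_f A E) ->
  exists2 p, prime p &
    forall x y, setminus_f A E x -> setminus_f A E y -> x = y %[mod p].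
Proof.
move=> Apos Acof nB; set B := setminus_f A E in nB *.
have gap x y : B x -> B y -> x <= y -> sumset_gap B (y - x).
  by move=> Bx By lexy; exists 1, x; rewrite subnKC //; split; apply: in_sumset1.
have [[a0 Ba0]|noB] := classic (exists a, B a); last first.
  by exists 2 => // x y Bx; case: noB; exists x.
suff [p pp pdvd] : exists2 p, prime p & forall d, sumset_gap B d -> p %| d.
  have le_case x y : B x -> B y -> x <= y -> x = y %[mod p].
    by move=> Bx By lexy; apply/eqP; rewrite eq_sym eqn_mod_dvd //; apply/pdvd/gap.
  exists p => // x y Bx By; have [|/ltnW] := leqP x y; first exact: le_case.
  by move/(le_case _ _ By Bx).
have [[d [d0 gd]]|nogap] := classic (exists d, 0 < d /\ sumset_gap B d); last first.
  exists 2 => // -[|d] gd //; by case: nogap; exists d.+1.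
have [g [g0 gg] ming] := @least_nat (fun d => 0 < d /\ sumset_gap B d) d (conj d0 gd).
have gdvd e : sumset_gap B e -> g %| e.
  move=> ge; rewrite /dvdn; have [//|ne] := eqVneq (e %% g) 0.
  case: (ming (e %% g)); first by rewrite ltn_mod.
  split; first by rewrite lt0n.
  have -> : e %% g = e - e %/ g * g by rewrite {2}(divn_eq e g) addKn.
  exact/sumset_gapB/sumset_gap_mul.
have [g1|g1] := leqP g 1; last first.
  exists (pdiv g); first exact: pdiv_prime.
  by move=> e /gdvd; apply: dvdn_trans (pdiv_dvd g).
have E1 : g = 1 by lia.
by case: nB; apply: (setminus_basis Apos Acof Ba0); rewrite -E1.
Qed.

(** * Upper bound *)

(** A sum of [h] entries of the finite list [U] is at most [h] times the sum of [U], so a larger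
    integer needs another summand. *)
Lemma cofinite_summand_notin h A (U : seq nat) :
  sumset_cofinite h A ->
  exists N0, forall n, N0 <= n -> exists s, [/\ size s = h,
    forall x, x \in s -> A x, sumn s = n & exists2 x, x \in s & x \notin U].
Proof.
move=> [N0 HN]; exists (N0 + h * \sum_(u <- U) u).+1 => n len.
have [||s [sz [As sumE]]] := HN n; try lia.
exists s; split=> //; apply/hasP; apply: contraTT len; rewrite -all_predC => sU.
rewrite -ltnNge ltnS -sumE -sz (leq_trans _ (leq_addl _ _)) //.
elim: s sU {sz As sumE} => //= x s IH /andP[/negPn Ux /IH].
by rewrite mulSn; apply: leq_add; rewrite (big_rem x) //= leq_addr.
Qed.

(* Sums of [j] elements of [V], with repetitions, so that there are [size V ^ j]. *)
Fixpoint sum_seq j (V : seq nat) : seq nat :=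
  if j is i.+1 then [seq u + v | u <- V, v <- sum_seq i V] else [:: 0].

Lemma size_sum_seq j V : size (sum_seq j V) = size V ^ j.
Proof. by elim: j => //= j IH; rewrite size_allpairs IH expnS. Qed.

Lemma sumn_in_sum_seq V s : {subset s <= V} -> sumn s \in sum_seq (size s) V.
Proof.
elim: s => [|x s IH] sV; first by rewrite mem_seq1.
apply: allpairs_f; first by apply: sV; rewrite mem_head.
by apply: IH => y sy; apply: sV; rewrite inE sy orbT.
Qed.

Lemma modn_prod_primes ps a b : uniq ps -> all prime ps ->
  (forall p, p \in ps -> a = b %[mod p]) -> a = b %[mod \prod_(p <- ps) p].
Proof.
elim: ps => [|p ps IH] /=; first by rewrite big_nil !modn1.
move=> /andP[nps ups] /andP[pp pps] H; rewrite big_cons; apply/eqP.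
rewrite chinese_remainder; last first.
rewrite prime_coprime // Euclid_dvd_prod // big_has; apply/hasPn => q qps.
  rewrite dvdn_prime2 //; last by apply: (allP pps).
  by apply: contraNneq nps => ->.
rewrite H ?mem_head // eqxx /=; apply/eqP/IH => // q qps.
by apply: H; rewrite inE qps orbT.
Qed.

(** By strict monotonicity the i-th entry of [s] is at least [c + i]. *)
Lemma fact_leq_prod_path c s :
  path ltn c s -> (c + size s)`! <= c`! * \prod_(x <- s) x.
Proof.
elim: s c => [|x s IH] c /=; first by rewrite addn0 big_nil muln1.
move=> /andP[ltcx xs]; rewrite big_cons addnS -addSn mulnA.
have /IH/leq_trans : path ltn c.+1 s.
  by case: s xs {IH} => //= y s /andP[ltxy ->]; rewrite (leq_ltn_trans ltcx).
by apply; rewrite factS leq_mul2r [c.+1 * _]mulnC leq_mul2l ltcx !orbT.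
Qed.

Lemma fact_leq_prod_uniq ps : uniq ps -> all (leq 2) ps ->
  (size ps).+1`! <= \prod_(p <- ps) p.
Proof.
move=> ups ps2; have /fact_leq_prod_path : path ltn 1 (sort leq ps).
  have : sorted ltn (sort leq ps).
    by rewrite ltn_sorted_uniq_leq sort_uniq ups sort_sorted //; apply: leq_total.
  have : all (leq 2) (sort leq ps) by rewrite all_sort.
  by case: (sort leq ps) => //= x s /andP[-> _] ->.
by rewrite size_sort add1n mul1n (perm_big ps) //= perm_sort.
Qed.

Definition essential_prime (A : nat -> Prop) (E : {fset nat}) (p : nat) : Prop :=
  prime p /\ forall x y, setminus_f A E x -> setminus_f A E y -> x = y %[mod p].

(** An element [a0] outside both sets ties their two classes together, so deleting only the
    intersection already leaves one class modulo [p]. Minimality then makes the intersection equal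
    to each set. *)
Lemma essential_prime_inj h A E1 E2 p :
  subset_pos A -> sumset_cofinite h A ->
  essential A E1 -> essential A E2 ->
  essential_prime A E1 p -> essential_prime A E2 p -> E1 = E2.
Proof.
move=> Apos Acof [E1A [_ min1]] [E2A [_ min2]] [pp mod1] [_ mod2].
have [N0 /(_ N0 (leqnn _))[s [_ sA _ [a0 /sA Aa0]]]] :=
  cofinite_summand_notin (enum_fset E1 ++ enum_fset E2) Acof.
rewrite mem_cat negb_or => /andP[a01 a02].
have toa0 x : setminus_f A (E1 `&` E2)%fset x -> x = a0 %[mod p].
  move=> [Ax]; rewrite in_fsetI negb_and => /orP[xE|xE].
    by apply: mod1.
  by apply: mod2.
have nb : ~ is_basis (setminus_f A (E1 `&` E2)%fset).
  by apply: (mod_class_not_basis (prime_gt1 pp)) => x y /toa0-> /toa0->.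
have [eq1|ne1] := eqVneq (E1 `&` E2)%fset E1; last first.
  by case: nb; apply: min1; rewrite fproperEneq ne1 fsubsetIl.
have [eq2|ne2] := eqVneq (E1 `&` E2)%fset E2; last first.
  by case: nb; apply: min2; rewrite fproperEneq ne2 fsubsetIr.
by rewrite -eq1 eq2.
Qed.

Lemma has_m_essential_fact h k m :
  0 < h -> has_m_essential h k m -> m.+1`! <= (m * k).+1 ^ h.-1.
Proof.
move=> h0 [A [[Apos [Acof _]] [s [us [sz sE]]]]].
pose p E := epsilon (inhabits 0) (essential_prime A E).
have pE E : E \in s -> essential_prime A E (p E).
  move=> /sE[[_ [nb _]] _]; apply: epsilon_spec.
  by have [q pq Hq] := not_basis_prime Apos Acof nb; exists q.
pose ps := [seq p E | E <- s].
have ups : uniq ps.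
  rewrite map_inj_in_uniq // => E1 E2 sE1 sE2 E12.
  have [ess1 _] := sE _ sE1; have [ess2 _] := sE _ sE2.
  by apply: (essential_prime_inj Apos Acof ess1 ess2 (pE _ sE1)); rewrite E12; apply: pE.
have pps : all prime ps by apply/allP => _ /mapP[E /pE[pp _] ->].
apply: (@leq_trans (\prod_(q <- ps) q)).
  rewrite -sz -(size_map p); apply: fact_leq_prod_uniq => //.
  by apply: sub_all pps; apply: prime_gt1.
set P := \prod_(q <- ps) q.
have P0 : 0 < P by rewrite /P big_seq prodn_cond_gt0 // => q /(allP pps)/prime_gt0.
pose U := flatten [seq enum_fset E | E <- s].
have sU : size U = m * k.
  rewrite size_flatten /shape -map_comp -sz.
  elim: s sE {us sz p pE ps ups pps P P0 U} => //= E s IH sE.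
  by rewrite IH ?(proj2 (sE E (mem_head _ _))) // => F sF; apply: sE; rewrite inE sF orbT.
have [N0 HN] := cofinite_summand_notin U Acof.
have [s0 [_ s0A _ [a0 /s0A Aa0 a0U]]] := HN N0 (leqnn _).
have notU x E : x \notin U -> E \in s -> x \notin E.
  by move=> xU Es; apply: contraNN xU => xE; apply/flattenP; exists (enum_fset E) => //; apply: map_f.
(* Elements of [A] outside [U] are all congruent to [a0] modulo [P]; [f] therefore leaves only the
   [m * k + 1] entries of [V] to choose from. *)
pose f x := if x \in U then x else a0.
have fmod x : A x -> f x = x %[mod P].
  move=> Ax; rewrite /f; case: ifPn => // xU; apply: modn_prod_primes => // _ /mapP[E Es ->].
  by apply: (proj2 (pE E Es)); split=> //; apply: notU.
have sumf t : (forall x, x \in t -> A x) -> sumn [seq f x | x <- t] = sumn t %[mod P].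
  elim: t => //= x t IH tA; rewrite -[LHS]modnDm -[RHS]modnDm fmod; last first.
    by apply: tA; rewrite mem_head.
  by rewrite IH // => y ty; apply: tA; rewrite inE ty orbT.
pose V := a0 :: U.
have -> : (m * k).+1 ^ h.-1 = size [seq (a0 + v) %% P | v <- sum_seq h.-1 V].
  by rewrite size_map size_sum_seq /= sU.
rewrite -[P in P <= _](size_iota 0); apply: uniq_leq_size; first exact: iota_uniq.
move=> r; rewrite mem_iota add0n /= => ltrP.
(* [N0 * P + r] represents the class of [r] and is at least [N0]. Its summand [x] outside [U] counts
   as [a0]; the other [h - 1] summands are sent into [V] by [f]. *)
have [|t [szt tA sumt [x xt xU]]] := HN (N0 * P + r).
  by rewrite (leq_trans _ (leq_addr _ _)) // leq_pmulr.
apply/mapP; exists (sumn [seq f y | y <- rem x t]).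
  have -> : h.-1 = size [seq f y | y <- rem x t] by rewrite size_map size_rem // szt.
  apply: sumn_in_sum_seq => _ /mapP[y _ ->]; rewrite /f inE.
  by case: ifP => [->|]; rewrite ?orbT ?eqxx.
have -> : r = sumn t %% P by rewrite sumt modnMDl modn_small.
rewrite (perm_sumn (perm_to_rem xt)) /= -modnDmr -(sumf (rem x t)); last first.
  by move=> y /mem_rem/tA.
by rewrite modnDmr -modnDml -(fmod x) ?modnDml /f ?(negbTE xU) //; apply: tA.
Qed.

(** * A basis built from blocks of primes *)

Definition squarefree (n : nat) : Prop := 0 < n /\ forall p, prime p -> ~~ (p * p %| n).

Lemma squarefree_dvd n z : squarefree n ->
  (forall p, p \in primes n -> p %| z) -> n %| z.
Proof.
move=> [n0 sqf] H; apply/dvdn_partP => // p pn.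
have pp : prime p by move: pn; rewrite mem_primes => /andP[].
rewrite p_part (@dvdn_trans (p ^ 1)) //; last by rewrite expn1; apply: H; rewrite -?pi_of_primes.
by rewrite dvdn_exp2l // -ltnS ltnNge -pfactor_dvdn // sqf.
Qed.

Lemma squarefree_div n p : squarefree n -> p \in primes n -> ~~ (p %| n %/ p).
Proof.
move=> [n0 sqf]; rewrite mem_primes => /and3P[pp _ dvp]; apply: contra (sqf p pp).
by rewrite dvdn_divRL.
Qed.

Lemma dvdn_div_prime n p q :
  p \in primes n -> q \in primes n -> q != p -> q %| n %/ p.
Proof.
rewrite !mem_primes => /and3P[pp _ dvp] /and3P[pq _]; rewrite -{1}(divnK dvp) Euclid_dvdM //.
by rewrite (dvdn_prime2 pq pp) orbC => /orP[->|].
Qed.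

(** Multiples of [cofactor g j] play the role of integers supported on block [j]: they vanish modulo
    every other block. *)
Definition cofactor H (g : 'I_H -> nat) (j : 'I_H) : nat := \prod_(i | i != j) g i.

Lemma cofactorE H (g : 'I_H -> nat) j : \prod_i g i = g j * cofactor g j.
Proof. by rewrite (bigD1 j). Qed.

Lemma dvdn_cofactor H (g : 'I_H -> nat) i j : i != j -> g j %| cofactor g i.
Proof. by move=> ij; rewrite /cofactor (bigD1 j) 1?eq_sym //= dvdn_mulr. Qed.

Lemma coprime_cofactor H (g : 'I_H -> nat) j :
  squarefree (\prod_i g i) -> coprime (g j) (cofactor g j).
Proof.
rewrite (cofactorE g j) => -[]; rewrite muln_gt0 => /andP[g0 c0] sqf.
rewrite /coprime eqn_leq gcdn_gt0 g0 andbT leqNgt; apply/negP => gt1.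
have [dg dc] := (dvdn_gcdl (g j) (cofactor g j), dvdn_gcdr (g j) (cofactor g j)).
have := sqf _ (pdiv_prime gt1); rewrite dvdn_mul //.
  by apply: dvdn_trans (pdiv_dvd _) dg.
by apply: dvdn_trans (pdiv_dvd _) dc.
Qed.

Definition block_residues H (g : 'I_H -> nat) (p : nat) : seq nat :=
  [seq x <- iota 1 (\prod_i g i) | ~~ (p %| x) && [exists j, cofactor g j %| x]].

(* The number of multiples of [P / p] to be added for the essential set of [p] to
   reach size [k]; the truncation is harmless as soon as every block is at most [k]. *)
Definition padding k H (g : 'I_H -> nat) (p : nat) : nat := k - size (block_residues g p).

(** For squarefree [P], [P / p] is divisible by every prime of [P] except [p], so a padding element
    enters the essential set of [p] only; [u > 0] puts it beyond [P], away from the block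
    residues. *)
Definition block_basis k H (g : 'I_H -> nat) (a : nat) : Prop :=
  let P := \prod_i g i in
  0 < a /\ [\/ P %| a,
               a <= P /\ exists j, cofactor g j %| a
             | exists p u, [/\ p \in primes P, 0 < u <= padding k g p & a = P %/ p + P * u]].

Definition block_essential k H (g : 'I_H -> nat) (p : nat) : seq nat :=
  block_residues g p ++
  [seq (\prod_i g i) %/ p + (\prod_i g i) * u | u <- iota 1 (padding k g p)].

Lemma primes_block H (g : 'I_H -> nat) p :
  p \in primes (\prod_i g i) -> exists j, p %| g j.
Proof.
rewrite mem_primes => /and3P[pp _]; rewrite Euclid_dvd_prod // big_has.
by case/hasP=> j _ pj; exists j.
Qed.

Lemma cofactor_dvd_div H (g : 'I_H -> nat) p j :
  p %| g j -> cofactor g j %| (\prod_i g i) %/ p.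
Proof. by move=> pj; rewrite (cofactorE g j) mulnC -muln_divA // dvdn_mulr. Qed.

(** Elements supported on another block, as well as the padding of another prime, are multiples of
    [p]. *)
Lemma block_basis_cofactor k H (g : 'I_H -> nat) p j x :
  p \in primes (\prod_i g i) -> p %| g j ->
  block_basis k g x -> ~~ (p %| x) -> cofactor g j %| x.
Proof.
move=> pP pj [x0 [Px|[_ [i cx]]|[q [u [qP _ ->]]]]] px.
- have /dvdn_trans/(_ Px) : p %| \prod_i g i by rewrite (cofactorE g j) dvdn_mulr.
  by rewrite (negPf px).
- have [<- //|ij] := eqVneq i j.
  by rewrite (dvdn_trans pj (dvdn_trans (dvdn_cofactor g ij) cx)) in px.
- have [<-|pq] := eqVneq p q.
    rewrite dvdn_add ?cofactor_dvd_div // (cofactorE g j) -mulnA mulnCA.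
    by rewrite dvdn_mulr.
  case/negP: px; apply: dvdn_add; first exact: dvdn_div_prime.
  by rewrite (cofactorE g j) -mulnA dvdn_mulr.
Qed.

Lemma block_basis_bounded k H (g : 'I_H -> nat) x :
  block_basis k g x -> ~~ (\prod_i g i %| x) -> x <= (\prod_i g i) * k.+1.
Proof.
move=> [x0 [->//|[xP _]|[p [u [pP /andP[_ ule] ->]]]]] _.
  by rewrite (leq_trans xP) // leq_pmulr.
by rewrite mulnS leq_add ?leq_div // leq_mul2l (leq_trans ule) ?orbT // leq_subr.
Qed.

Lemma mem_block_essential k H (g : 'I_H -> nat) p x :
  squarefree (\prod_i g i) -> p \in primes (\prod_i g i) ->
  x \in block_essential k g p <-> block_basis k g x /\ ~~ (p %| x).
Proof.
move=> sqf pP; have [j pj] := primes_block pP.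
have dvP : p %| \prod_i g i by rewrite (cofactorE g j) dvdn_mulr.
rewrite mem_cat; split.
  case/orP=> [|/mapP[u]].
    rewrite mem_filter mem_iota => /andP[/andP[px /existsP[i ci]]].
    rewrite add1n ltnS => /andP[x0 xP]; split=> //; split=> //.
    by apply: Or32; split=> //; exists i.
  rewrite mem_iota add1n ltnS => up ->; split; last first.
    by rewrite dvdn_addl ?squarefree_div // dvdn_mulr.
  split; last by apply: Or33; exists p, u.
  rewrite addn_gt0; case/andP: up => u0 _.
  by rewrite [0 < _ * _]muln_gt0 u0 (proj1 sqf) orbT.
move=> [[x0 [Px|[xP [i ci]]|[q [u [qP up ->]]]]] px].
- by rewrite (dvdn_trans dvP Px) in px.
- rewrite mem_filter px mem_iota x0 add1n ltnS xP; apply/orP; left.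
  by rewrite !andbT /=; apply/existsP; exists i.
- have [pq|pq] := eqVneq p q.
    apply/orP; right; apply/mapP; exists u; last by rewrite pq.
    by rewrite mem_iota add1n ltnS pq.
  case/negP: px; apply: dvdn_add; first exact: dvdn_div_prime.
  by rewrite dvdn_mulr.
Qed.

(** Elements of other blocks are multiples of [p], so what remains lies among the [g j] multiples of
    [cofactor g j] in one period. *)
Lemma size_block_residues H (g : 'I_H -> nat) p j :
  squarefree (\prod_i g i) -> p %| g j -> size (block_residues g p) <= g j.
Proof.
move=> sqf pj; rewrite -[leqRHS](size_iota 1) -[leqRHS](size_map (fun t => t * cofactor g j)).
have P0 := proj1 sqf; rewrite (cofactorE g j) muln_gt0 in P0; case/andP: P0 => g0 c0.
apply: uniq_leq_size; first by rewrite /block_residues filter_uniq ?iota_uniq.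
move=> x; rewrite mem_filter mem_iota add1n ltnS => /andP[/andP[px /existsP[i ci]] /andP[x0 xP]].
have [ij|ij] := eqVneq i j; last first.
  by rewrite (dvdn_trans pj (dvdn_trans (dvdn_cofactor g ij) ci)) in px.
rewrite ij in ci; apply/mapP; exists (x %/ cofactor g j); last by rewrite divnK.
by rewrite mem_iota add1n ltnS divn_gt0 // dvdn_leq // leq_divLR // -cofactorE.
Qed.

Lemma uniq_block_essential k H (g : 'I_H -> nat) p :
  squarefree (\prod_i g i) -> p \in primes (\prod_i g i) ->
  uniq (block_essential k g p).
Proof.
move=> [P0 _] pP; rewrite cat_uniq /block_residues filter_uniq ?iota_uniq //=; apply/andP; split; last first.
  rewrite map_inj_uniq ?iota_uniq // => u v /eqP.
  by rewrite eqn_add2l eqn_pmul2l // => /eqP.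
apply/hasPn => x /mapP[u uP ->{x}]; move: uP; rewrite mem_iota => /andP[u0 _] /=.
rewrite mem_filter mem_iota add1n ltnS [X in _ && X]andbC.
move: pP; rewrite mem_primes => /and3P[pp _ /(dvdn_leq P0) pleP].
have : \prod_i g i < (\prod_i g i) %/ p + \prod_i g i * u.
  by rewrite -add1n leq_add ?divn_gt0 ?prime_gt0 ?leq_pmulr.
by rewrite ltnNge => /negPf->; rewrite andbF.
Qed.

Lemma size_block_essential k H (g : 'I_H -> nat) p :
  squarefree (\prod_i g i) -> (forall j, g j <= k) ->
  p \in primes (\prod_i g i) -> size (block_essential k g p) = k.
Proof.
move=> sqf gk pP; have [j pj] := primes_block pP.
rewrite size_cat size_map size_iota /padding subnKC //.
exact: leq_trans (size_block_residues sqf pj) (gk j).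
Qed.

Lemma block_basis_pos k H (g : 'I_H -> nat) : subset_pos (block_basis k g).
Proof. by move=> a []. Qed.

Lemma block_residue H (g : 'I_H -> nat) j n : squarefree (\prod_i g i) ->
  exists x, [/\ 0 < x <= \prod_i g i, cofactor g j %| x & x = n %[mod g j]].
Proof.
move=> sqf; have P0 := proj1 sqf.
have coP := coprime_cofactor j sqf.
pose x0 := chinese (g j) (cofactor g j) n 0.
have x0c : cofactor g j %| x0 by rewrite /dvdn chinese_modr // mod0n.
have x0n : x0 = n %[mod g j] by rewrite chinese_modl.
have cP : cofactor g j %| \prod_i g i by rewrite (cofactorE g j) dvdn_mull.
have gP : g j %| \prod_i g i by rewrite (cofactorE g j) dvdn_mulr.
(* Elements of the basis must be positive, so the residue 0 is represented by the full product. *)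
have [x0P|x0P] := posnP (x0 %% \prod_i g i).
  exists (\prod_i g i); split=> //; first by rewrite P0 leqnn.
  rewrite -x0n; apply/eqP; rewrite (eqP gP) eq_sym.
  by apply: dvdn_trans gP _; rewrite /dvdn x0P.
exists (x0 %% \prod_i g i); split; first by rewrite x0P ltnW // ltn_mod.
  by rewrite /dvdn modn_dvdm.
by rewrite modn_dvdm.
Qed.

(** Take for each block an [x j] agreeing with [n] modulo [g j]. The other [x i] vanish there, so
    [n] minus their sum is a multiple of the product, positive because [n] exceeds [H] periods. *)
Lemma block_basis_cofinite k H (g : 'I_H -> nat) :
  squarefree (\prod_i g i) -> sumset_cofinite H.+1 (block_basis k g).
Proof.
move=> sqf; exists (H * \prod_i g i).+1 => n ltn _.
have [x xP] := fin_all_exists (fun j => block_residue j n sqf).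
have xle : \sum_j x j <= H * \prod_i g i.
  have -> : H * \prod_i g i = \sum_(j < H) \prod_i g i.
    by rewrite sum_nat_const card_ord.
  rewrite leq_sum // => j _.
  by have [/andP[]] := xP j.
exists ((n - \sum_j x j) :: [seq x j | j <- enum 'I_H]); split; last split.
- by rewrite /= size_map size_enum_ord.
- move=> y; rewrite inE => /orP[/eqP->|/mapP[j _ ->]]; last first.
    have [/andP[x0 xle'] cx _] := xP j; split=> //.
    by apply: Or32; split=> //; exists j.
  split; first by rewrite subn_gt0; apply: leq_ltn_trans xle ltn.
  apply: Or31; apply: squarefree_dvd => // p /primes_block[j pj].
  apply: dvdn_trans pj _; rewrite -eqn_mod_dvd; last exact: leq_trans xle (ltnW ltn).
  rewrite (bigD1 j) //= -modnDmr; have [_ _ <-] := xP j.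
  suff /eqP-> : g j %| \sum_(i | i != j) x i by rewrite addn0.
  apply: dvdn_sum => i ij; have [_ cx _] := xP i.
  exact: dvdn_trans (dvdn_cofactor g ij) cx.
- rewrite /= sumnE big_map big_enum /= subnK //.
  exact: leq_trans xle (ltnW ltn).
Qed.

(* An integer coprime to [P] needs, for each of the [H] blocks, a summand not
   divisible by some prime of the block; such a summand serves only one block, so
   [H] summands would all lie among the bounded elements. *)
Lemma block_basis_not_cofinite k H (g : 'I_H -> nat) :
  squarefree (\prod_i g i) -> (forall j, 1 < g j) ->
  ~ sumset_cofinite H (block_basis k g).
Proof.
move=> sqf g1 [N0 HN]; have P0 := proj1 sqf; set P := \prod_i g i in sqf P0 *.
(* Being 1 modulo [P], [n] is divisible by no prime of [P]; it also exceeds [N0] and every sum of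
   [H] bounded elements. *)
pose n := 1 + P * (N0 + H * (P * k.+1)).
have nP p : prime p -> p %| P -> ~~ (p %| n).
  move=> pp pP; rewrite /n dvdn_addl ?dvdn_mulr // Euclid_dvd1 //.
have leN : N0 + H * (P * k.+1) < n by rewrite /n add1n ltnS leq_pmull.
have [||s [sz [sA sumE]]] := HN n; try lia.
have gP j : g j %| P by rewrite /P (cofactorE g j) dvdn_mulr.
have pgP j : pdiv (g j) \in primes P.
  by rewrite mem_primes pdiv_prime //= P0 (dvdn_trans (pdiv_dvd _)).
have [f fP] : exists f : 'I_H -> 'I_H, forall j, ~~ (pdiv (g j) %| nth 0 s (f j)).
  apply: (fin_all_exists (P := fun j i => ~~ (pdiv (g j) %| nth 0 s (i : 'I_H)))) => j.
  have /hasP[x xs px] : has (fun x => ~~ (pdiv (g j) %| x)) s.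
    apply: contraT; rewrite -all_predC => /allP sp.
    have := nP _ (pdiv_prime (g1 j)) (dvdn_trans (pdiv_dvd _) (gP j)).
    rewrite -sumE sumnE big_seq dvdn_sum // => x /sp /=; by rewrite negbK.
  have xi : index x s < H by rewrite -sz index_mem.
  by exists (Ordinal xi); rewrite /= nth_index.
have sAi (i : 'I_H) : block_basis k g (nth 0 s i).
  by apply: sA; rewrite mem_nth ?sz.
have finj : injective f.
  move=> i j fij; apply/eqP; apply: contraT => ij.
  have := block_basis_cofactor (pgP i) (pdiv_dvd _) (sAi (f i)) (fP i).
  move=> /(dvdn_trans (dvdn_cofactor g ij)) /(dvdn_trans (pdiv_dvd _)).
  by rewrite fij (negPf (fP j)).
have [f' _ f'K] := injF_bij finj.
suff : sumn s <= H * (P * k.+1) by rewrite sumE; lia.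
have -> : H * (P * k.+1) = \sum_(j < H) P * k.+1 by rewrite sum_nat_const card_ord.
rewrite sumnE (big_nth 0) big_mkord sz leq_sum // => i _.
apply: block_basis_bounded => //; apply: contra (fP (f' i)); rewrite f'K.
by apply: dvdn_trans; apply: dvdn_trans (pdiv_dvd _) (gP _).
Qed.

Lemma has_m_essential_blocks k H (g : 'I_H -> nat) :
  squarefree (\prod_i g i) -> (forall j, 1 < g j <= k) ->
  has_m_essential H.+1 k (size (primes (\prod_i g i))).
Proof.
move=> sqf gk; have P0 := proj1 sqf; set P := \prod_i g i in sqf P0 *.
have cof := block_basis_cofinite k sqf.
exists (block_basis k g); split.
  split; first exact: block_basis_pos.
  by split=> //; apply: block_basis_not_cofinite => // j; case/andP: (gk j).
pose E p : {fset nat} := [fset x in block_essential k g p]%fset.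
have memE p x : p \in primes P -> x \in E p <-> block_basis k g x /\ ~~ (p %| x).
  by move=> pP; rewrite in_fset; apply: mem_block_essential.
have PA : block_basis k g P by split=> //; apply: Or31.
have divA p : p \in primes P -> block_basis k g (P %/ p).
  move=> pP; have [j pj] := primes_block pP.
  split; first by move: pP; rewrite mem_primes => /and3P[pp _ /(dvdn_leq P0)]; rewrite divn_gt0 // prime_gt0.
  by apply: Or32; split; [apply: leq_div | exists j; apply: cofactor_dvd_div].
have dvP p : p \in primes P -> p %| P by rewrite mem_primes => /and3P[].
have prP p : p \in primes P -> prime p by rewrite mem_primes => /and3P[].
exists [seq E p | p <- primes P]; split; last split; last 1 first.
- move=> _ /mapP[p pP ->]; split; last first.
    rewrite card_fseq undup_id; last exact: uniq_block_essential.
    by rewrite size_block_essential // => j; case/andP: (gk j).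
  split; first by move=> x /(memE _ _ pP)[].
  split.
    apply: (mod_class_not_basis (prime_gt1 (prP p pP))) => x y [Ax xE] [Ay yE].
    have dvE z : block_basis k g z -> z \notin E p -> p %| z.
      by move=> Az; apply: contraR => pz; apply/(memE _ _ pP).
    by rewrite (eqP (dvE x Ax xE)) (eqP (dvE y Ay yE)).
  move=> E'; rewrite fproperE => /andP[/fsubsetP sub /fsubsetPn[x xE xE']]; apply: NNPP => nb.
  have [q pq qmod] := not_basis_prime (@block_basis_pos k H g) cof nb.
  have inB z : block_basis k g z -> p %| z -> setminus_f (block_basis k g) E' z.
    by move=> Az pz; split=> //; apply/negP => /sub/(memE _ _ pP)[_]; rewrite pz.
  (* [P] and [2 P] are multiples of [p], hence survive the deletion of [E'], and [q] divides their
     difference. *)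
  have q_dvP : q %| P.
    have := qmod (P * 2) P; rewrite muln2 -addnn => /(_ _ _)/eqP.
    rewrite eqn_mod_dvd ?leq_addr // addnK; apply; apply: inB => //.
    - by split; [rewrite addn_gt0 P0 | apply: Or31; apply: dvdn_add].
    - by rewrite dvdn_add ?dvP.
    - exact: dvP.
  have qP : q \in primes P by rewrite mem_primes pq P0.
  have q_all z : setminus_f (block_basis k g) E' z -> q %| z.
    by move=> Bz; rewrite /dvdn (qmod z P Bz (inB P PA (dvP p pP))).
  (* If [q = p], the element [x] of [E p] missed by [E'] is not a multiple of [p]. Otherwise [P / q]
     survives as a multiple of [p], yet [q] does not divide it. *)
  have [qp|qp] := eqVneq q p.
    have [Ax px] := (memE p x pP).1 xE.
    by case/negP: px; rewrite -qp; apply: q_all.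
  case/negP: (squarefree_div sqf qP); apply: q_all.
  by apply: inB (divA _ qP) _; apply: dvdn_div_prime; rewrite // eq_sym.
- rewrite map_inj_in_uniq ?primes_uniq // => p q pP qP Epq.
  have : P %/ p \in E q.
    by rewrite -Epq; apply/(memE _ _ pP); split; [apply: divA | apply: squarefree_div].
  move=> /(memE _ _ qP)[_]; apply: contraNeq => pq.
  by apply: dvdn_div_prime => //; rewrite eq_sym.
- by rewrite size_map.
Qed.

(** * Prime divisors of the central binomial coefficient *)

Lemma squarefree_prod ps : uniq ps -> all prime ps -> squarefree (\prod_(p <- ps) p).
Proof.
move=> ups pps; split; first by rewrite big_seq prodn_cond_gt0 // => p /(allP pps)/prime_gt0.
move=> p pp; apply/negP => ppd; have p0 := prime_gt0 pp.
have : p %| \prod_(q <- ps) q by apply: dvdn_trans ppd; apply: dvdn_mulr.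
rewrite Euclid_dvd_prod // big_has => /hasP[q qps]; rewrite dvdn_prime2 // ?(allP pps) // => /eqP pq.
move: ppd; rewrite pq (big_rem q) //= dvdn_pmul2l -?pq // Euclid_dvd_prod // big_has.
case/hasP=> q' /[dup] /mem_rem q'ps; rewrite dvdn_prime2 // ?(allP pps) // => + /eqP pq'.
by rewrite -pq' pq mem_rem_uniq // inE eqxx.
Qed.

Lemma size_primes_prod ps : uniq ps -> all prime ps ->
  size (primes (\prod_(p <- ps) p)) = size ps.
Proof.
move=> ups pps; apply/perm_size/uniq_perm; rewrite ?primes_uniq // => p.
rewrite mem_primes (proj1 (squarefree_prod ups pps)) /=.
apply/idP/idP => [/andP[pp]|pin].
  rewrite Euclid_dvd_prod // big_has => /hasP[q qps].
  by rewrite dvdn_prime2 // ?(allP pps) // => /eqP->.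
by rewrite (allP pps) // (big_rem p) //= dvdn_mulr.
Qed.

Lemma sum_leq_nat m t : \sum_(1 <= i < m.+1) (i <= t) <= t.
Proof.
suff -> : \sum_(1 <= i < m.+1) (i <= t) = minn m t by apply: geq_minr.
elim: m => [|m IH]; first by rewrite big_geq // min0n.
by rewrite big_nat_recr //= IH; case: (leqP m.+1 t) => /=; lia.
Qed.

Lemma logn_fact_widen p n m : prime p -> n <= m ->
  logn p n`! = \sum_(1 <= i < m.+1) n %/ p ^ i.
Proof.
move=> pp lenm; rewrite logn_fact // [RHS](@big_cat_nat _ _ _ n.+1) //=.
rewrite [X in _ + X]big_nat_cond [X in _ + X]big1 ?addn0 // => i /andP[/andP[lti _] _].
by rewrite divn_small // (leq_trans lti) // ltnW // ltn_expl // prime_gt1.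
Qed.

(* Legendre: each [i] with [p ^ i <= 2n] contributes at most [1] to
   [logn p 'C(2n, n)], and larger [i] contribute nothing. *)
Lemma pow_logn_central_bin p n : 0 < n -> prime p -> p ^ logn p 'C(n.*2, n) <= n.*2.
Proof.
move=> n0 pp; have n2 : 0 < n.*2 by rewrite double_gt0.
have nle : n <= n.*2 by rewrite -addnn leq_addr.
apply: leq_trans (trunc_logP (prime_gt1 pp) n2).
rewrite leq_exp2l ?prime_gt1 //.
have /(congr1 (logn p)) := bin_fact nle.
rewrite -[X in X - n]addnn addnK !lognM ?muln_gt0 ?fact_gt0 ?bin_gt0 //.
rewrite (logn_fact_widen pp (leqnn n.*2)) (logn_fact_widen pp nle) => Elog.
rewrite -(leq_add2r (\sum_(1 <= i < n.*2.+1) n %/ p ^ i + \sum_(1 <= i < n.*2.+1) n %/ p ^ i)).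
rewrite Elog; apply: (@leq_trans (\sum_(1 <= i < n.*2.+1)
    ((i <= trunc_log p n.*2) + (n %/ p ^ i + n %/ p ^ i)))); last first.
  by rewrite !big_split /= leq_add2r sum_leq_nat.
apply: leq_sum => i _; have pi0 : 0 < p ^ i by rewrite expn_gt0 prime_gt0.
case: (leqP i (trunc_log p n.*2)) => [_|lti].
  rewrite -ltnS ltn_divLR // {1}(divn_eq n (p ^ i)) doubleD -!addnn.
  have := ltn_pmod n pi0; nia.
rewrite divn_small //; apply: leq_trans (trunc_log_ltn _ (prime_gt1 pp)) _.
by rewrite leq_exp2l ?prime_gt1.
Qed.

(** Pascal's rule splits the next central coefficient into two equal terms, each at least the
    present one. *)
Lemma exp2_leq_central_bin n : 2 ^ n <= 'C(n.*2, n).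
Proof.
elim: n => [|n IH]; first by rewrite bin0.
rewrite doubleS binS expnS mul2n -addnn.
have le1 : 2 ^ n <= 'C(n.*2.+1, n.+1) by rewrite binS (leq_trans IH) // leq_addl.
apply: leq_add => //; rewrite -bin_sub; last by rewrite -addnn; lia.
by have -> : n.*2.+1 - n = n.+1 by rewrite -addnn; lia.
Qed.

(** A Chebyshev bound: each prime power in the factorization of the central coefficient is at most
    [2n]. *)
Lemma exp2_leq_pow_primes n : 0 < n ->
  2 ^ n <= n.*2 ^ size (primes 'C(n.*2, n)).
Proof.
move=> n0; apply: leq_trans (exp2_leq_central_bin n) _.
have c0 : 0 < 'C(n.*2, n) by rewrite bin_gt0 -addnn leq_addr.
rewrite [leqLHS]prod_prime_decomp // prime_decompE big_map /=.
rewrite (big_nth 0) big_mkord -[X in _ ^ X]card_ord -prod_nat_const.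
apply: leq_prod => i _; apply: pow_logn_central_bin => //.
by have := mem_nth 0 (ltn_ord i); rewrite mem_primes => /andP[].
Qed.

Lemma leq_prime_central_bin p n : 0 < n -> p \in primes 'C(n.*2, n) -> p <= n.*2.
Proof.
move=> n0 pC; have := pC; rewrite mem_primes => /and3P[pp _ _].
apply: leq_trans (pow_logn_central_bin n0 pp); rewrite -[leqLHS]expn1 leq_exp2l ?prime_gt1 //.
by rewrite logn_gt0.
Qed.

(** Each block is a run of [r] entries of the list of primes; as these are at most [2n], its product
    is at most [(2n) ^ r]. *)
Lemma has_m_essential_primes H r n k :
  0 < n -> 0 < r -> H * r <= size (primes 'C(n.*2, n)) -> n.*2 ^ r <= k ->
  has_m_essential H.+1 k (H * r).
Proof.
move=> n0 r0 Hr rk; set ps := primes _ in Hr.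
pose qs := take (H * r) ps.
have sqs : size qs = H * r by rewrite size_take_min (minn_idPl Hr).
have uqs : uniq qs by rewrite take_uniq ?primes_uniq.
have pqs : all prime qs.
  by apply/allP => p /mem_take; rewrite mem_primes => /andP[].
pose g (j : 'I_H) := \prod_(j * r <= t < j.+1 * r) nth 0 qs t.
have gE : \prod_j g j = \prod_(q <- qs) q.
  by rewrite (big_nth 0) sqs big_nat_mul big_mkord.
rewrite -sqs -(size_primes_prod uqs pqs) -gE; apply: has_m_essential_blocks.
  by rewrite gE; apply: squarefree_prod.
have qsP (j : 'I_H) t : j * r <= t < j.+1 * r -> nth 0 qs t \in qs.
  move=> /andP[_ ltt]; rewrite mem_nth // sqs (leq_trans ltt) // leq_mul2r.
  by rewrite ltn_ord orbT.
have subr (j : 'I_H) : j.+1 * r - j * r = r by rewrite mulSn addnK.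
move=> j; apply/andP; split.
  have lt2r : 1 < 2 ^ r by rewrite -{1}(expn0 2) ltn_exp2l.
  apply: leq_trans lt2r _; rewrite -(subr j) -prod_nat_const_nat.
  rewrite big_nat [leqRHS]big_nat; apply: leq_prod => t /qsP/(allP pqs).
  exact: prime_gt1.
apply: leq_trans rk; rewrite -(subr j) -prod_nat_const_nat.
rewrite /g big_nat [leqRHS]big_nat; apply: leq_prod => t /qsP/mem_take.
exact: leq_prime_central_bin.
Qed.

(** * Growth estimates *)

Lemma INR_expn a b : INR (a ^ b) = (INR a ^ b)%R.
Proof. by elim: b => // b IH; rewrite expnS -[muln]/Nat.mul mult_INR IH. Qed.

Lemma ln_le_sub1 x : (0 < x)%R -> (ln x <= x - 1)%R.
Proof. by move=> x0; have := exp_ineq1_le (ln x); rewrite exp_ln //; lra. Qed.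

Lemma ln_leq x y : (0 < x)%R -> (x <= y)%R -> (ln x <= ln y)%R.
Proof. by move=> x0 [lt|->]; [left; apply: ln_increasing | right]. Qed.

Lemma ln_div x y : (0 < x)%R -> (0 < y)%R -> (ln (x / y) = ln x - ln y)%R.
Proof. by move=> x0 y0; rewrite ln_mult ?ln_Rinv //; apply: Rinv_0_lt_compat. Qed.

(** The weak Stirling bound, by induction from [ln (1 + 1/m) <= 1/m]. *)
Lemma ln_fact_ge m : (INR m * ln (INR m) - INR m <= ln (INR m`!))%R.
Proof.
elim: m => [|m IH]; first by rewrite /= ln_1; lra.
rewrite factS -[muln]/Nat.mul mult_INR S_INR.
have f0 : (0 < INR m`!)%R by apply: lt_0_INR; apply/ltP; apply: fact_gt0.
have m0 := pos_INR m.
rewrite ln_mult; [|lra|exact: f0].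
suff : (INR m * (ln (INR m + 1) - ln (INR m)) <= 1)%R by lra.
have [m_eq0|mpos] : INR m = 0%R \/ (0 < INR m)%R by lra.
  by rewrite m_eq0; lra.
rewrite -ln_div; [|lra|exact: mpos].
have := @ln_le_sub1 ((INR m + 1) / INR m).
have -> : ((INR m + 1) / INR m - 1 = / INR m)%R by field; lra.
have d0 : (0 < (INR m + 1) / INR m)%R by apply: Rdiv_lt_0_compat; lra.
move=> /(_ d0) le1; rewrite -[X in (_ <= X)%R](Rinv_r (INR m)); last lra.
by apply: Rmult_le_compat_l; lra.
Qed.

Lemma nat_floor x : (0 <= x)%R -> exists n, (INR n <= x < INR n + 1)%R.
Proof.
move=> x0; have [n0 xn0] := INR_unbounded x.
have [|n ltx minn] := @least_nat (fun n => x < INR n + 1)%R n0; first lra.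
exists n; split=> //; case: n ltx minn => // n _ minn.
by have := minn n (ltnSn n); rewrite S_INR; lra.
Qed.

(* In both growth lemmas [y] stands for [ln ln k], so [exp y] is [ln k]. *)
Lemma log_growth_upper (H eps : R) : (1 <= H)%R -> (0 < eps <= 1)%R ->
  exists Y, forall y m, (Y <= y)%R -> (0 < m)%R ->
    (m * ln m - m <= H * (ln (m + 1) + exp y))%R ->
    (m <= (1 + eps) * (H * (exp y / y)))%R.
Proof.
move=> H1 [eps0 eps1]; pose d := (/ eps)%R.
have epsd : (eps * d = 1)%R by rewrite Rinv_r //; lra.
have d1 : (1 <= d)%R by nra.
exists (32 * d * d + 24 * d + 8 * H + 8)%R => y m leY m0 Hm.
have y0 : (0 < y)%R by nra.
(* If [m > M], then [ln m >= y - ln y] is almost [y], which is too large for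
   [m * (ln m - 2) <= H * exp y]. *)
apply: Rnot_lt_le => ltm; set M := ((1 + eps) * _)%R in ltm.
have e0 := exp_pos y.
have ey0 : (0 < exp y / y)%R by apply: Rdiv_lt_0_compat.
have eyM : (exp y / y <= M)%R.
  rewrite /M; move: (exp y / y)%R ey0 => q q0 {ltm M}.
  have q1 : (q <= H * q)%R by clear - H1 q0; nra.
  have : (0 <= eps * (H * q))%R by clear - eps0 q1 q0; nra.
  lra.
(* Splitting [y] into the factors [eps * y / 4] and [4 * d], whose logarithms are bounded linearly,
   makes [ln y] small against [eps * y]. *)
have lny : (ln y <= eps * y / 4 + 4 * d)%R.
  have -> : y = (eps * y / 4 * (4 * d))%R.
    by transitivity ((eps * d) * y)%R; [rewrite epsd; lra | field].
  have p1 : (0 < eps * y / 4)%R by nra.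
  have p2 : (0 < 4 * d)%R by lra.
  have := ln_le_sub1 p1; have := ln_le_sub1 p2; rewrite (ln_mult _ _ p1 p2).
  have -> : (eps * (eps * y / 4 * (4 * d)) / 4 = eps * y / 4)%R.
    by transitivity ((eps * d) * (eps * y / 4))%R; [field | rewrite epsd; lra].
  lra.
have lnm : (y - ln y <= ln m)%R.
  have <- : ln (exp y / y) = (y - ln y)%R by rewrite ln_div // ln_exp.
  by apply: ln_leq => //; lra.
have epsy : (eps * y >= 32 * d + 24)%R.
  have : (eps * (32 * d * d + 24 * d) <= eps * y)%R by apply: Rmult_le_compat_l; nra.
  have -> : (eps * (32 * d * d + 24 * d) = (eps * d) * (32 * d + 24))%R by ring.
  by rewrite epsd; lra.
have big_ln : (4 * H <= ln m)%R by nra.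
(* The term [H * u] is absorbed into [m]: as [m + 1] is the square of [exp (u / 2)], [m] is at least
   [u * u / 4], and [u >= 4 * H]. *)
pose u := ln (m + 1)%R.
have lnu : (ln m <= u)%R by apply: ln_leq; lra.
have mu : (H * u <= m)%R.
  have : m = (exp (u / 2) * exp (u / 2) - 1)%R.
    rewrite -exp_plus; have -> : (u / 2 + u / 2 = u)%R by field.
    by rewrite exp_ln; lra.
  have := exp_ineq1_le (u / 2); nra.
have key : (m * (ln m - 2) <= H * exp y)%R by rewrite -/u in Hm; nra.
have key2 : (M * (ln m - 2) <= H * exp y)%R by nra.
have : ((1 + eps) * (ln m - 2) <= y)%R.
  apply: (Rmult_le_reg_l (H * (exp y / y))); first by nra.
  have -> : (H * (exp y / y) * y = H * exp y)%R by field; lra.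
  by rewrite /M in key2; nra.
nra.
Qed.

Lemma log_growth_lower (H eps : R) : (0 <= H)%R -> (0 < eps < 1)%R ->
  exists Y, forall y, (Y <= y)%R -> exists r n : nat,
    [/\ (0 < r)%N, (0 < n)%N, ((1 - eps) * (exp y / y) <= INR r)%R,
        (INR r * ln (INR n.*2) <= exp y)%R &
        forall c, (INR n * ln 2 <= c * ln (INR n.*2))%R -> (H * INR r <= c)%R].
Proof.
move=> H0 [eps0 eps1]; pose d := (/ eps)%R.
have epsd : (eps * d = 1)%R by rewrite Rinv_r //; lra.
have d1 : (1 <= d)%R by nra.
exists (8 * d * d + 32 * (H + 1) * d + 1)%R => y leY.
have y1 : (1 <= y)%R by nra.
have Hd : (0 <= H * d)%R by nra.
have epsy : (eps * y >= 8 * d + 32 * (H + 1))%R.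
  have : (eps * (8 * d * d + 32 * (H + 1) * d) <= eps * y)%R by apply: Rmult_le_compat_l; nra.
  have -> : (eps * (8 * d * d + 32 * (H + 1) * d) = (eps * d) * (8 * d + 32 * (H + 1)))%R by ring.
  by rewrite epsd; lra.
have expy : (y * y / 4 <= exp y)%R.
  have -> : (exp y = exp (y / 2) * exp (y / 2))%R by rewrite -exp_plus; congr exp; field.
  have := exp_ineq1_le (y / 2); nra.
have e0 := exp_pos y.
pose L := exp y; rewrite -/L in expy e0 *.
have Ly0 : (0 < L / y)%R by apply: Rdiv_lt_0_compat; lra.
have LyE : (L / y * y = L)%R by field; lra.
have Ly1 : (1 <= L / y)%R.
  apply: (Rmult_le_reg_r y); first lra.
  rewrite LyE; nra.
have [|s [sle slt]] := @nat_floor ((1 - eps) * (L / y)); first by nra.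
(* [n] is about [(ln k) ^ (1 + eps) / 2]. *)
pose X := exp ((1 + eps) * y).
have XE : X = (L * exp (eps * y))%R by rewrite /X /L -exp_plus; congr exp; ring.
have Xbig : (32 * (H + 1) * L <= X)%R.
  have := exp_ineq1_le (eps * y); rewrite XE; nra.
have L1 : (1 <= L)%R by have := exp_ineq1_le y; rewrite -/L; lra.
have X4 : (32 <= X)%R by nra.
have [|n [nle nlt]] := @nat_floor (X / 2); first by lra.
have n0 : (15 <= INR n)%R by lra.
have INR2 : (INR n.*2 = 2 * INR n)%R by rewrite -addnn -[addn]/Nat.add plus_INR; ring.
have ln2n : (ln (INR n.*2) <= (1 + eps) * y)%R.
  rewrite -[X in (_ <= X)%R]ln_exp -/X INR2; apply: ln_leq; lra.
have ln2n0 : (0 < ln (INR n.*2))%R by rewrite -ln_1 INR2; apply: ln_increasing; lra.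
exists s.+1, n; rewrite S_INR; split=> //.
- by apply/ltP; apply: INR_lt; rewrite /=; lra.
- by lra.
(* The factors [1 - eps] from [r] and [1 + eps] from [ln (2n)] leave a slack [eps * eps * L], which
   absorbs the cost of rounding [r] up. *)
- apply: (@Rle_trans _ (((1 - eps) * (L / y) + 1) * ((1 + eps) * y))).
    by apply: Rmult_le_compat; have := pos_INR s; lra.
  have -> : (((1 - eps) * (L / y) + 1) * ((1 + eps) * y) =
     (1 - eps * eps) * (L / y * y) + (1 + eps) * y)%R by ring.
  rewrite LyE.
  suff : (2 * y <= eps * eps * L)%R by nra.
  have : (eps * eps * (y * y / 4) <= eps * eps * L)%R by apply: Rmult_le_compat_l; nra.
  have : (8 * y <= eps * eps * (y * y))%R.
    have -> : (eps * eps * (y * y) = (eps * (eps * y)) * y)%R by ring.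
    apply: Rmult_le_compat_r; first lra.
    have : (eps * (8 * d) <= eps * (eps * y))%R by apply: Rmult_le_compat_l; nra.
    have -> : (eps * (8 * d) = 8 * (eps * d))%R by ring.
    by rewrite epsd; lra.
  lra.
(* [c] is at least of order [X / y], and [X >= 32 * (H + 1) * L] outweighs [H * r], where [r] is at
   most [2 * (L / y)]. *)
- move=> c cle.
  have ln2 : (1 / 2 <= ln 2)%R by have := ln_lt_2; lra.
  have c0 : (0 < c)%R by nra.
  have cX : (X / 8 <= c * (2 * y))%R.
    have : (c * ln (INR n.*2) <= c * (2 * y))%R by apply: Rmult_le_compat_l; nra.
    nra.
  apply: (@Rle_trans _ (H * (2 * (L / y)))); first by apply: Rmult_le_compat_l; nra.
  apply: (Rmult_le_reg_r (2 * y)); first lra.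
  have -> : (H * (2 * (L / y)) * (2 * y) = 4 * H * (L / y * y))%R by ring.
  rewrite LyE; nra.
Qed.

(** * Asymptotics *)

Lemma ex_max_bounded (Q : nat -> Prop) m0 (B : R) :
  Q m0 -> (forall m, Q m -> (INR m <= B)%R) ->
  exists m, Q m /\ forall m', Q m' -> m' <= m.
Proof.
move=> Qm0 QB; have [b bB] := INR_unbounded B.
have Qb m : Q m -> m <= b.
  by move=> /QB le; apply/leP/INR_le; lra.
have [|d Qd mind] := @least_nat (fun d => Q (b - d)) (b - m0).
  by rewrite subKn // Qb.
exists (b - d); split=> // m Qm; have lemb := Qb m Qm.
rewrite leqNgt; apply/negP => ltm; apply: (mind (b - m)); last by rewrite subKn.
lia.
Qed.

Lemma eventually_lnln (Y : R) :
  exists K, forall k, K <= k ->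
    [/\ (1 <= INR k)%R, (Y <= ln (ln (INR k)))%R, (0 < ln (ln (INR k)))%R
      & exp (ln (ln (INR k))) = ln (INR k)].
Proof.
pose Z := Rmax Y 1; have [YZ Z1] : (Y <= Z)%R /\ (1 <= Z)%R.
  by split; [apply: Rmax_l | apply: Rmax_r].
have [K ltK] := INR_unbounded (exp (exp Z)); exists K => k leKk.
have lek : (exp (exp Z) <= INR k)%R by have := le_INR _ _ (leP leKk); lra.
have e0 := exp_pos Z; have ee0 := exp_pos (exp Z).
have le1 : (exp Z <= ln (INR k))%R by rewrite -{1}(ln_exp (exp Z)); apply: ln_leq.
have le2 : (Z <= ln (ln (INR k)))%R by rewrite -{1}(ln_exp Z); apply: ln_leq.
have := exp_ineq1_le (exp Z); split; try lra.
by rewrite exp_ln //; lra.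
Qed.

Lemma fact_bound_upper (H : nat) (eps : R) : (0 < eps <= 1)%R ->
  exists K, forall k, K <= k -> forall m, m.+1`! <= (m * k).+1 ^ H ->
    (INR m <= (1 + eps) * (INR H * (ln (INR k) / ln (ln (INR k)))))%R.
Proof.
move=> eps01; case: H => [|H].
  exists 0 => k _ [|m]; first by move=> _ /=; lra.
  by have f0 := fact_gt0 m.+1; rewrite expn0 factS => le1; exfalso; nia.
have H1 : (1 <= INR H.+1)%R by rewrite S_INR; have := pos_INR H; lra.
have [Y HY] := log_growth_upper H1 eps01.
have [K HK] := eventually_lnln Y; exists K => k leKk m lem.
have [k1 leY y0 yE] := HK k leKk.
have L0 : (0 < ln (INR k))%R by rewrite -yE; apply: exp_pos.
case: m lem => [_|m lem].
  have : (0 < ln (INR k) / ln (ln (INR k)))%R by apply: Rdiv_lt_0_compat.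
  move=> q0; rewrite [INR 0]/=; apply: Rmult_le_pos; first lra.
  by apply: Rmult_le_pos; lra.
rewrite -{1}yE; apply: HY => //; first by apply: lt_0_INR; lia.
rewrite yE; apply: Rle_trans (ln_fact_ge _) _.
have f0 : (0 < INR m.+1`!)%R by apply: lt_0_INR; apply/ltP; apply: fact_gt0.
(* In this product form the logarithm splits into the [ln (m + 1) + exp y] of [log_growth_upper];
   the spare factor [m + 2] of the factorial is dropped. *)
have lef : m.+1`! <= (m.+2 * k) ^ H.+1.
  have k0 : 0 < k by apply/ltP/INR_lt; rewrite [INR 0]/=; lra.
  apply: leq_trans (leq_trans lem _).
    by rewrite factS leq_pmull.
  by rewrite leq_exp2r // mulSn -addn1 addnC leq_add2r.
have m2 : (0 < INR m.+2)%R by apply: lt_0_INR; lia.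
apply: (@Rle_trans _ (ln (INR ((m.+2 * k) ^ H.+1)))).
  by apply: ln_leq => //; apply: le_INR; apply/leP.
rewrite INR_expn -[muln]/Nat.mul mult_INR ln_pow; last by apply: Rmult_lt_0_compat; lra.
by rewrite ln_mult //; [rewrite -S_INR; lra | lra].
Qed.

Lemma primes_count_lower (H : nat) (eps : R) : (0 < eps < 1)%R ->
  exists K, forall k, K <= k -> exists r n, [/\ 0 < r, 0 < n,
    ((1 - eps) * (ln (INR k) / ln (ln (INR k))) <= INR r)%R,
    n.*2 ^ r <= k & H * r <= size (primes 'C(n.*2, n))].
Proof.
move=> eps01; have [Y HY] := log_growth_lower (pos_INR H) eps01.
have [K HK] := eventually_lnln Y; exists K => k leKk.
have [k1 leY y0 yE] := HK k leKk.
have [r [n [r0 n0 rge rle cle]]] := HY _ leY; rewrite yE in rge rle.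
have n2 : (0 < INR n.*2)%R by apply: lt_0_INR; apply/ltP; rewrite double_gt0.
exists r, n; split=> //.
  apply/leP/INR_le; rewrite INR_expn; apply: Rnot_lt_le => ltk.
  by have := ln_increasing _ _ (Rlt_le_trans _ _ _ Rlt_0_1 k1) ltk; rewrite ln_pow //; lra.
apply/leP/INR_le; rewrite -[muln]/Nat.mul mult_INR; apply: cle.
have -> : (INR n * ln 2 = ln (INR (2 ^ n)))%R.
  by rewrite INR_expn ln_pow /=; [congr (_ * ln _)%R|]; lra.
rewrite -ln_pow // -INR_expn; apply: ln_leq.
  by apply: lt_0_INR; apply/ltP; rewrite expn_gt0.
by apply: le_INR; apply/leP; apply: exp2_leq_pow_primes.
Qed.

Theorem theorem1p1 (h : nat) (hpos : 0 < h) :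
  asymp_equiv (fun k => INR (Ehk h k))
              (fun k => (INR (h - 1) * (ln (INR k) / ln (ln (INR k))))%R).
Proof.
(* The cap [1 / 2] meets the range conditions on [eps] in both bounds. *)
case: h hpos => // H _ eps eps0; pose e := Rmin eps (1 / 2).
have [e0 [e1 e2]] : (0 < e /\ e <= eps /\ e <= 1 / 2)%R.
  split; first by apply: Rmin_glb_lt; lra.
  by split; [apply: Rmin_l | apply: Rmin_r].
have [|K1 HK1] := @fact_bound_upper H e; first lra.
have [|K2 HK2] := @primes_count_lower H e; first lra.
have [K3 HK3] := eventually_lnln 0.
exists (K1 + K2 + K3) => k leKk.
have [r [n [r0 n0 rge rle cle]]] := HK2 k ltac:(lia).
have [_ _ y0 yE] := HK3 k ltac:(lia).
rewrite subn1 /=; set G := (ln _ / _)%R in rge *.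
have upper m : has_m_essential H.+1 k m -> (INR m <= (1 + e) * (INR H * G))%R.
  by move=> /(has_m_essential_fact (ltn0Sn H)); apply: HK1; lia.
have has_lower := has_m_essential_primes n0 r0 cle rle.
(* The lower construction shows that some value is attained and the upper bound that the values are
   bounded, so [epsilon] returns a genuine maximum. *)
have [HE Emax] : is_max_essential H.+1 k (Ehk H.+1 k).
  by apply: epsilon_spec; apply: (ex_max_bounded has_lower upper).
have le_up := upper _ HE.
have le_low : (INR H * INR r <= INR (Ehk H.+1 k))%R.
  by rewrite -mult_INR; apply: le_INR; apply/leP/Emax.
have H0 := pos_INR H.
have G0 : (0 < G)%R by apply: Rdiv_lt_0_compat => //; rewrite -yE; apply: exp_pos.
have HG : (0 <= INR H * G)%R by apply: Rmult_le_pos; lra.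
have low2 : (INR H * ((1 - e) * G) <= INR H * INR r)%R by apply: Rmult_le_compat_l.
have eG : (e * (INR H * G) <= eps * (INR H * G))%R by apply: Rmult_le_compat_r.
rewrite (Rabs_pos_eq (INR H * G)) //; apply: Rabs_le; nra.
Qed.
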